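(* Consider one-vertex $\mathcal R$-graphs $G_{\mathcal R}=G_{\mathcal R}(\{\mathfrak p\},\mathcal E^-\cup\mathcal E^+)$ with relation $\mathcal R\subset\mathcal E^-\times\mathcal E^+$ such that $\mathfrak p\notin\mathfrak P^{(1)}_{\mathcal R}$ (that is, $\mathcal R\ne\mathcal E^-\times\mathcal E^+$) and $$\{e^-\in\mathcal E^-:\{e^-\}\times\mathcal E^+\subset\mathcal R\}=\emptyset,\qquad \{e^+\in\mathcal E^+:\mathcal E^-\times\{e^+\}\subset\mathcal R\}=\emptyset .$$ For such $\mathcal R$-graphs the topological conjugacy class of the $\mathcal R$-graph shift $X(G_{\mathcal R})$ determines the isomorphism class of the $\mathcal R$-graph $G_{\mathcal R}$; that is, if two $\mathcal R$-graphs satisfying these conditions have topologically conjugate $\mathcal R$-graph shifts, then they are isomorphic as $\mathcal R$-graphs.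
   Context: A one-vertex $\mathcal R$-graph $G_{\mathcal R}(\{\mathfrak p\},\mathcal E^-\cup\mathcal E^+)$ consists of a single vertex $\mathfrak p$, two disjoint finite non-empty sets of loops $\mathcal E^-$ and $\mathcal E^+$ at $\mathfrak p$, and a relation $\mathcal R\subset\mathcal E^-\times\mathcal E^+$ that is complete: each $e^-\in\mathcal E^-$ is related to at least one $e^+\in\mathcal E^+$ and each $e^+\in\mathcal E^+$ to at least one $e^-\in\mathcal E^-$. Its semigroup $\mathcal S(G_{\mathcal R})$ is the semigroup with zero and identity $\mathbf 1_{\mathfrak p}$ generated by $\mathcal E^-\cup\mathcal E^+$ with defining relations, for $f^-\in\mathcal E^-$, $g^+\in\mathcal E^+$: $f^-g^+=\mathbf 1_{\mathfrak p}$ if $(f^-,g^+)\in\mathcal R$ and $f^-g^+=0$ if $(f^-,g^+)\notin\mathcal R$. The $\mathcal R$-graph shift $X(G_{\mathcal R})\subset(\mathcal E^-\cup\mathcal E^+)^{\mathbb Z}$ is the subshift whose admissible words are the finite words $\sigma_1\cdots\sigma_I$ over $\mathcal E^-\cup\mathcal E^+$ with $\prod_{1\le i\le I}\sigma_i\neq0$ in $\mathcal S(G_{\mathcal R})$. For a one-vertex $\mathcal R$-graph, $\mathfrak P^{(1)}_{\mathcal R}=\{\mathfrak p\}$ if $\mathcal R=\mathcal E^-\times\mathcal E^+$ and $\mathfrak P^{(1)}_{\mathcal R}=\emptyset$ otherwise. An isomorphism of one-vertex $\mathcal R$-graphs is a pair of bijections between the sets $\mathcal E^-$ and between the sets $\mathcal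 E^+$ that carries one relation onto the other. *)

(* Defs.v *)
From HB Require Import structures.
From mathcomp Require Import all_boot all_order all_algebra.
From mathcomp Require Import all_classical all_reals all_analysis.

Set Implicit Arguments.
Unset Strict Implicit.
Unset Printing Implicit Defensive.

Local Open Scope classical_set_scope.

Record Rgraph1 := MkRgraph1 {
  Eminus : finType;
  Eplus : finType;
  Rrel : set (Eminus * Eplus);
  Eminus_neq0 : [set: Eminus] !=set0;
  Eplus_neq0 : [set: Eplus] !=set0;
  Rrel_completel : forall em : Eminus, exists ep : Eplus, Rrel (em, ep);
  Rrel_completer : forall ep : Eplus, exists em : Eminus, Rrel (em, ep) }.

Arguments Rrel : clear implicits.

(* The disjoint union of the two sets of loops: [inl] marks the elements of
   E^-, [inr] those of E^+. *)
Definition loops (G : Rgraph1) : finType := (Eminus G + Eplus G)%type.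

Definition Rgraph1_iso (G H : Rgraph1) : Prop :=
  exists (phi : Eminus G -> Eminus H) (psi : Eplus G -> Eplus H),
    [/\ bijective phi, bijective psi &
        forall em ep, Rrel G (em, ep) <-> Rrel H (phi em, psi ep)].

(* The free monoid with zero on A is [option (seq A)]: [None] is the zero,
   [Some [::]] the identity, and [Some w] the product of the letters of w. *)
Definition mul0 (A : Type) (u v : option (seq A)) : option (seq A) :=
  match u, v with
  | Some a, Some b => Some (a ++ b)
  | _, _ => None
  end.

(* The semigroup S(G_R) is the quotient of the free monoid with zero on the
   loops by the following congruence, the smallest one that contains the
   defining relations. *)
Inductive Seq_in (G : Rgraph1) :
    option (seq (loops G)) -> option (seq (loops G)) -> Prop :=
| Seq_rel1 fm gp : Rrel G (fm, gp) ->
    Seq_in (Some [:: inl fm; inr gp]) (Some [::])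
| Seq_rel0 fm gp : ~ Rrel G (fm, gp) ->
    Seq_in (Some [:: inl fm; inr gp]) None
| Seq_refl u : Seq_in u u
| Seq_sym u v : Seq_in u v -> Seq_in v u
| Seq_trans u v w : Seq_in u v -> Seq_in v w -> Seq_in u w
| Seq_mul u u' v v' : Seq_in u u' -> Seq_in v v' ->
    Seq_in (mul0 u v) (mul0 u' v').

Definition admissible (G : Rgraph1) (w : seq (loops G)) : Prop :=
  ~ Seq_in (Some w) None.

(* A^Z with the product topology, A being discrete. *)
Notation full_shift A := {ptws int -> discrete_topology A}.

Definition shift (A : choiceType) (x : full_shift A) : full_shift A :=
  fun i => x (i + 1)%R.

(* The word x_i x_(i+1) ... x_(i+n-1). *)
Definition factor (A : choiceType) (x : full_shift A) (i : int) (n : nat) :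
    seq A :=
  [seq x (i + k%:Z)%R | k <- iota 0 n].

Definition Rgraph_shift (G : Rgraph1) : set (full_shift (loops G)) :=
  [set x | forall (i : int) (n : nat), admissible (factor x i n)].

Arguments Rgraph_shift : clear implicits.

(* A homeomorphism of X onto Y, for the subspace topologies, that commutes
   with the shifts; the values of f off X and of g off Y are irrelevant. *)
Definition topologically_conjugate (A B : choiceType)
    (X : set (full_shift A)) (Y : set (full_shift B)) : Prop :=
  exists (f : full_shift A -> full_shift B) (g : full_shift B -> full_shift A),
    [/\ set_fun X Y f /\ set_fun Y X g,
        (forall x, X x -> g (f x) = x) /\ (forall y, Y y -> f (g y) = y),
        {within X, continuous f} /\ {within Y, continuous g} &
        forall x, X x -> f (shift x) = shift (f x)].

(* Main.v *)
(* Say that a loop a is joined to a loop b when the shift contains a point that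
   is left asymptotic to the fixed point a^oo and right asymptotic to b^oo.  The
   only pairs that are not joined are the pairs (e^-, g^+) outside of R: far to
   the left the letters e^-, and far to the right the letters g^+, absorb
   whatever finite word stands in between, and e^- g^+ = 0 remains.  A conjugacy
   maps fixed points bijectively to fixed points and preserves joinedness.  By
   hypothesis every e^- is the left member, and every g^+ the right member, of
   a pair that is not joined; hence the conjugacy respects the splitting of the
   loops, and the pairs that are not joined give back the complement of R. *)

Require Import Defs.
From mathcomp Require Import all_boot all_order all_algebra.
From mathcomp Require Import all_classical all_reals all_analysis.
From mathcomp Require Import zify.

Set Implicit Arguments.
Unset Strict Implicit.
Unset Printing Implicit Defensive.

Import Order.TTheory GRing.Theory Num.Theory.

Local Open Scope classical_set_scope.

(** * Admissible words through the action on stacks *)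

Section Stack.
Context {G : Rgraph1}.
Implicit Types (s t : seq (Eminus G)) (w : seq (loops G)) (e h : Eminus G).

(* S(G_R) acts by partial maps on stacks of elements of E^-, with zero acting as
   the empty map; hence a word that is defined on some stack is admissible. *)
Definition stack_step (l : loops G) s : option (seq (Eminus G)) :=
  match l, s with
  | inl e, _ => Some (e :: s)
  | inr g, h :: t => if `[< Rrel G (h, g) >] then Some t else None
  | inr _, [::] => None
  end.

Fixpoint stack_act w s : option (seq (Eminus G)) :=
  if w is l :: w' then obind (stack_act w') (stack_step l s) else Some s.

Definition stack_act0 (u : option (seq (loops G))) s :=
  if u is Some w then stack_act w s else None.

Lemma stack_act_cat w1 w2 s :
  stack_act (w1 ++ w2) s = obind (stack_act w2) (stack_act w1 s).
Proof. by elim: w1 s => //= l w IH s; case: stack_step. Qed.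

Lemma stack_act0_mul u v s :
  stack_act0 (mul0 u v) s = obind (stack_act0 v) (stack_act0 u s).
Proof.
case: u v => [u|] [v|] //=; first exact: stack_act_cat.
by case: stack_act.
Qed.

Lemma Seq_in_stack_act0 u v : Seq_in u v -> stack_act0 u =1 stack_act0 v.
Proof.
elim=> {u v}.
- by move=> f g fg s /=; rewrite asboolT.
- by move=> f g fg s /=; rewrite asboolF.
- by [].
- by move=> u v _ uv s; rewrite uv.
- by move=> u v w _ uv _ vw s; rewrite uv.
- move=> u u' v v' _ uu' _ vv' s; rewrite !stack_act0_mul uu'.
  by case: stack_act0 => //= t.
Qed.

Lemma stack_act_admissible w s t : stack_act w s = Some t -> admissible w.
Proof. by move=> wst /Seq_in_stack_act0/(_ s) /=; rewrite wst. Qed.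

Lemma stack_act_push n e s :
  stack_act (nseq n (inl e)) s = Some (nseq n e ++ s).
Proof.
elim: n s => //= n IH s; rewrite IH -cat1s catA.
by rewrite -[[:: e]]/(nseq 1 e) -nseqD addn1.
Qed.

Lemma stack_act_pop n h g s : Rrel G (h, g) ->
  stack_act (nseq n (inr g)) (nseq n h ++ s) = Some s.
Proof. by move=> hg; elim: n => //= n IH; rewrite asboolT. Qed.

(** The initial stack is chosen to hold what the letters of E^+ pop: partners given by completeness
    of R, or, when [a] is in E^- and [b] in E^+, [m] copies of the letter of [a] itself, so that the
    pops succeed whatever [n] is. *)
Lemma nseq_admissible (n m : nat) (a b : loops G) :
  (forall e g, a = inl e -> b = inr g -> Rrel G (e, g)) ->
  admissible (nseq n a ++ nseq m b).
Proof.
case: a b => [e|g] [e'|g'] ab.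
- apply: (@stack_act_admissible _ [::] (nseq m e' ++ nseq n e ++ [::])).
  by rewrite stack_act_cat stack_act_push /= stack_act_push.
- apply: (@stack_act_admissible _ (nseq m e) (nseq n e)).
  rewrite stack_act_cat stack_act_push /= -nseqD addnC nseqD.
  exact/stack_act_pop/ab.
- have [h hg] := Rrel_completer g.
  apply: (@stack_act_admissible _ (nseq n h ++ [::]) (nseq m e' ++ [::])).
  by rewrite stack_act_cat stack_act_pop //= stack_act_push.
- have [h hg] := Rrel_completer g; have [h' hg'] := Rrel_completer g'.
  apply: (@stack_act_admissible _ (nseq n h ++ nseq m h' ++ [::]) [::]).
  by rewrite stack_act_cat stack_act_pop //= stack_act_pop.
Qed.

End Stack.

(** * Absorption and words equal to zero *)

Section Zero.
Context {G : Rgraph1}.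
Implicit Types (u v w : seq (loops G)) (p : seq (Eplus G)) (q : seq (Eminus G)).

Lemma Seq_in_sandwich v w u (u' : option (seq (loops G))) :
  Seq_in (Some u) u' ->
  Seq_in (Some (v ++ u ++ w)) (mul0 (Some v) (mul0 u' (Some w))).
Proof.
move=> uu'.
exact: (Seq_mul (Seq_refl (Some v)) (Seq_mul uu' (Seq_refl (Some w)))).
Qed.

Lemma Seq_in_cancel v w (e : Eminus G) (g : Eplus G) :
  Seq_in (Some (v ++ [:: inl e; inr g] ++ w)) None \/
  Seq_in (Some (v ++ [:: inl e; inr g] ++ w)) (Some (v ++ w)).
Proof.
have [eg|neg] := pselect (Rrel G (e, g)).
- right; exact: (Seq_in_sandwich v w (Seq_rel1 eg)).
- left; exact: (Seq_in_sandwich v w (Seq_rel0 neg)).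
Qed.

(** Letters are added on the left: one of E^+ extends [p], one of E^- meets the first letter of [p]
    and either cancels it or gives zero. *)
Lemma Seq_in_normal_form w : Seq_in (Some w) None \/
  exists p q, Seq_in (Some w) (Some (map inr p ++ map inl q)).
Proof.
elim: w => [|l w [w0|[p [q wpq]]]].
- by right; exists [::], [::]; exact: Seq_refl.
- by left; exact: (Seq_mul (Seq_refl (Some [:: l])) w0).
have lwpq := Seq_mul (Seq_refl (Some [:: l])) wpq.
case: l p wpq lwpq => [e|g] [|g' p] wpq lwpq.
- by right; exists [::], (e :: q).
- have [z|z] := Seq_in_cancel [::] (map inr p ++ map inl q) e g'.
    by left; exact: Seq_trans lwpq z.
  by right; exists p, q; exact: Seq_trans lwpq z.
- by right; exists [:: g], q.
- by right; exists [:: g, g' & p], q.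
Qed.

(** From the junction outwards, each letter of [p] cancels one copy of [e] or produces zero; the [k]
    surplus copies survive. *)
Lemma Seq_in_nseq_inl (e : Eminus G) p k :
  let w := nseq (size p + k) (inl e) ++ map inr p in
  Seq_in (Some w) None \/ Seq_in (Some w) (Some (nseq k (inl e))).
Proof.
elim: p => /= [|g p IH]; first by right; rewrite cats0; exact: Seq_refl.
rewrite -cat_cons -[_ :: nseq _ _]/(nseq (size p + k).+1 _) -addn1 nseqD -catA.
have [z|z] := Seq_in_cancel (nseq (size p + k) (inl e)) (map inr p) e g.
  by left.
by case: IH => z'; [left|right]; exact: Seq_trans z z'.
Qed.

Lemma Seq_in_nseq_inr (g : Eplus G) q k :
  let w := map inl q ++ nseq (size q + k) (inr g) in
  Seq_in (Some w) None \/ Seq_in (Some w) (Some (nseq k (inr g))).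
Proof.
elim/last_ind: q => /= [|q e IH]; first by right; exact: Seq_refl.
rewrite size_rcons map_rcons cat_rcons /=.
have [z|z] := Seq_in_cancel (map inl q) (nseq (size q + k) (inr g)) e g.
  by left.
by case: IH => z'; [left|right]; exact: Seq_trans z z'.
Qed.

Lemma not_Rrel_Seq_in0 (e : Eminus G) (g : Eplus G) w : ~ Rrel G (e, g) ->
  exists n m, Seq_in (Some (nseq n (inl e) ++ w ++ nseq m (inr g))) None.
Proof.
move=> neg; have [w0|[p [q wpq]]] := Seq_in_normal_form w.
  by exists 0, 0; exact: (Seq_in_sandwich _ _ w0).
(* One copy beyond what absorbing [p] and [q] takes leaves the product of [e] and [g], which is
   zero. *)
exists (size p + 1), (size q + 1).
apply: Seq_trans (Seq_in_sandwich _ _ wpq) _ => /=.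
rewrite -catA catA.
have [pz|pz] := Seq_in_nseq_inl e p 1; have [qz|qz] := Seq_in_nseq_inr g q 1;
  apply: Seq_trans (Seq_mul pz qz) _; try exact: Seq_refl.
exact: Seq_rel0.
Qed.

End Zero.

(** * Powers of the shift, factors and heteroclinic points *)

Section FullShift.
Context {A : choiceType}.
Implicit Types (x : full_shift A) (i k : int).

Definition shiftz k x : full_shift A := fun i => x (i + k)%R.

Lemma shiftz0 x : shiftz 0%R x = x.
Proof. by apply/funext => i; rewrite /shiftz addr0. Qed.

Lemma shiftzD i k x : shiftz i (shiftz k x) = shiftz (i + k)%R x.
Proof. by apply/funext => j; rewrite /shiftz addrA. Qed.

Lemma shiftzS (n : nat) x : shiftz n.+1 x = Defs.shift (shiftz n x).
Proof.
by apply/funext => i; rewrite /shiftz /Defs.shift -addrA -PoszD add1n.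
Qed.

Lemma factorD x i n m :
  Defs.factor x i (n + m) = Defs.factor x i n ++ Defs.factor x (i + n%:Z)%R m.
Proof.
rewrite /Defs.factor iotaD map_cat add0n -{2}[n]addn0 iotaDl -map_comp.
congr (_ ++ _); apply: eq_map => j /=.
by rewrite PoszD addrA.
Qed.

Lemma factor_nseq x i n a :
  (forall k : nat, k < n -> x (i + k%:Z)%R = a) -> Defs.factor x i n = nseq n a.
Proof.
move=> xa; have /all_pred1P : all (pred1 a) (Defs.factor x i n).
  by apply/allP => _ /mapP[k + ->]; rewrite mem_iota => /xa /= ->.
by rewrite size_map size_iota.
Qed.

Lemma factor_shiftz k x i n :
  Defs.factor (shiftz k x) i n = Defs.factor x (i + k)%R n.
Proof. by apply: eq_map => j; rewrite /shiftz addrAC. Qed.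

Definition heteroclinic (X : set (full_shift A)) (a b : A) :=
  exists x : full_shift A, [/\ X x, \forall n \near \oo, x (- n%:Z)%R = a &
    \forall n \near \oo, x n%:Z%R = b].

End FullShift.

(** * Heteroclinic points under a conjugacy *)

Section Conjugacy.
Context {A B : choiceType} (X : set (full_shift A)) (Y : set (full_shift B)).
Variable f : full_shift A -> full_shift B.
Hypothesis X_shiftz : forall k x, X x -> X (shiftz k x).
Hypothesis fXY : set_fun X Y f.
Hypothesis fct : {within X, continuous f}.
Hypothesis f_shift : forall x, X x -> f (Defs.shift x) = Defs.shift (f x).

Lemma conj_shiftz k x : X x -> f (shiftz k x) = shiftz k (f x).
Proof.
have pos (n : nat) y : X y -> f (shiftz n y) = shiftz n (f y).
  move=> Xy; elim: n => [|n IH]; first by rewrite !shiftz0.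
  by rewrite !shiftzS f_shift ?IH //; exact: X_shiftz.
case: (intP k) => [|n|n] Xx; [exact: (pos 0)|exact: pos|].
have XNx := X_shiftz (- n.+1%:Z)%R Xx.
have {2}-> : x = shiftz n.+1 (shiftz (- n.+1%:Z)%R x).
  by rewrite shiftzD subrr shiftz0.
by rewrite pos // shiftzD addNr shiftz0.
Qed.

Lemma conj_cst a : X (cst a) -> f (cst a) = cst (f (cst a) 0%R).
Proof.
move=> Xa; apply/funext => i.
by rewrite -[i in LHS]add0r -[LHS]/(shiftz i (f (cst a)) 0%R) -conj_shiftz.
Qed.

(** The points [shiftz (u n) x] converge to [cst b], hence their images to [f (cst b)]. The alphabet
    being discrete, coordinate 0 of these images, which is [f x (u n)], is eventually constant. A
    general [u] serves both ends of the line. *)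
Lemma conj_asymptotic x b (u : nat -> int) : X x -> X (cst b) ->
  (forall i, \forall n \near \oo, x (i + u n)%R = b) ->
  \forall n \near \oo, f x (u n) = f (cst b) 0%R.
Proof.
move=> Xx Xb xb.
have cvgx : (fun n => shiftz (u n) x) @ \oo --> (cst b : full_shift A).
  apply/cvg_sup => i U [V] [[W] oW <-] Wb VU; apply: (filterS VU).
  by apply: filterS (xb i) => n xn; rewrite /= /shiftz xn.
have fb0 : nbhs (f (cst b)) [set y : full_shift B | y 0%R = f (cst b) 0%R].
  have := @proj_continuous int (fun=> discrete_topology B) 0%R (f (cst b)).
  move/(_ [set f (cst b) 0%R]); apply; exact: discrete_set1.
have [N _ fN] := cvgx _ ((subspace_continuousP _ _).1 fct _ Xb _ fb0).
exists N => // n /fN /(_ (X_shiftz _ Xx)).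
by rewrite /preimage/= /from_subspace/= conj_shiftz // /shiftz add0r.
Qed.

Lemma conj_heteroclinic a b : X (cst a) -> X (cst b) ->
  heteroclinic X a b -> heteroclinic Y (f (cst a) 0%R) (f (cst b) 0%R).
Proof.
move=> Xa Xb [x [Xx xa xb]]; exists (f x); split; first exact: fXY.
- apply: conj_asymptotic => // i.
  case: xa => N _ xa; exists (N + `|i|)%N => // n /= Nin.
  (* The coordinate i - n is -(n - i), and n >= N + |i| gives n - i >= N, so that [xa] applies. *)
  rewrite -(opprK i) -opprD.
  have [m Nm ->] : exists2 m : nat, N <= m & (- i + n%:Z)%R = m%:Z%R.
    by exists `|(- i + n%:Z)%R|%N; lia.
  exact: xa.
- apply: conj_asymptotic => // i.
  case: xb => N _ xb; exists (N + `|i|)%N => // n /= Nin.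
  have [m Nm ->] : exists2 m : nat, N <= m & (i + n%:Z)%R = m%:Z%R.
    by exists `|(i + n%:Z)%R|%N; lia.
  exact: xb.
Qed.

End Conjugacy.

(** * Joined pairs of loops *)

Section RgraphShift.
Context {G : Rgraph1}.
Implicit Types (a b : loops G) (x : full_shift (loops G)).

Lemma Rgraph_shift_shiftz k x : Rgraph_shift G x -> Rgraph_shift G (shiftz k x).
Proof. by move=> Gx i n; rewrite factor_shiftz. Qed.

(** Combinatorial counterpart of [heteroclinic], vacuously true unless [a] is in E^- and [b] in
    E^+. *)
Definition joined a b := forall e g, a = inl e -> b = inr g -> Rrel G (e, g).

Lemma Rgraph_shift_step a b : joined a b ->
  Rgraph_shift G (fun i => if (i < 0)%R then a else b).
Proof.
move=> ab i n; set x := fun i => _.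
(* [m] counts the letters of the factor that sit at negative coordinates. *)
pose m := if (i < 0)%R then minn `|i| n else 0.
have mn : m <= n by rewrite /m; case: ifP; lia.
rewrite -(subnKC mn) factorD.
rewrite (@factor_nseq _ x i m a) => [|k]; last first.
  by rewrite /m /x; case: ifP => // ? km; rewrite ifT //; lia.
rewrite (@factor_nseq _ x _ _ b) => [|k]; first exact: nseq_admissible.
by rewrite /m /x => km; rewrite ifF //; case: ifP km; lia.
Qed.

Lemma Rgraph_shift_cst a : Rgraph_shift G (cst a).
Proof.
rewrite (_ : cst a = fun i : int => if (i < 0)%R then a else a).
  by apply: Rgraph_shift_step => e g ->.
by apply/funext => i; case: ifP.
Qed.

Lemma heteroclinicP a b : heteroclinic (Rgraph_shift G) a b <-> joined a b.
Proof.
split=> [[x [Gx [N _ xa] [M _ xb]]] e g ae bg|ab]; last first.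
  exists (fun i => if (i < 0)%R then a else b); split.
  - exact: Rgraph_shift_step.
  - by exists 1%N => // n /= n0; rewrite ifT //; lia.
  - by exists 0%N => // n /= n0; rewrite ifF //; lia.
(* The central word runs from -N to M - 1; outside it [x] is constant on each side, so extending it
   by [n] and [m] letters gives a factor of [x] that would be zero. *)
apply: contrapT => /(not_Rrel_Seq_in0 (Defs.factor x (- N%:Z)%R (N + M))).
move=> [n [m]].
have <- : Defs.factor x (- N%:Z - n%:Z)%R n = nseq n (inl e).
  apply: factor_nseq => k kn; rewrite -ae.
  have -> : (- N%:Z - n%:Z + k%:Z = - (N + (n - k))%N%:Z)%R by lia.
  by apply: xa => /=; lia.
have <- : Defs.factor x M%:Z%R m = nseq m (inr g).
  by apply: factor_nseq => k km; rewrite -bg; apply: (xb (M + k)) => /=; lia.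
have -> : (- N%:Z = - N%:Z - n%:Z + n%:Z)%R by rewrite subrK.
rewrite (_ : M%:Z = - N%:Z - n%:Z + n%:Z + (N + M)%N%:Z)%R; last by lia.
rewrite addrK -!factorD => xz; exact: Gx xz.
Qed.

End RgraphShift.

Arguments Rgraph_shift_shiftz {G} k x.
Arguments Rgraph_shift_cst {G} a.

(** * From the conjugacy back to the relation *)

Lemma conj_joined (G H : Rgraph1) :
  topologically_conjugate (Rgraph_shift G) (Rgraph_shift H) ->
  exists (F : loops G -> loops H) (F' : loops H -> loops G),
    [/\ cancel F F', cancel F' F &
        forall a b, joined a b <-> joined (F a) (F b)].
Proof.
move=> [f [g [[fGH gHG] [fK gK] [fct gct] f_shift]]].
(* The inverse commutes with the shift as well, so joinedness is also carried from [H] back to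
   [G]. *)
have g_shift y : Rgraph_shift H y -> g (Defs.shift y) = Defs.shift (g y).
  move=> Hy; have Gy := gHG _ Hy.
  rewrite -[in LHS](gK _ Hy) -f_shift // fK //.
  exact: (Rgraph_shift_shiftz 1%R _ Gy).
(* Constant points are the fixed points of the shift; the letter of the image is read off at
   coordinate 0. *)
have fcst a := conj_cst Rgraph_shift_shiftz f_shift (Rgraph_shift_cst a).
have gcst a := conj_cst Rgraph_shift_shiftz g_shift (Rgraph_shift_cst a).
have FK : cancel (fun a : loops G => f (cst a) 0%R)
                 (fun a : loops H => g (cst a) 0%R).
  by move=> a; rewrite -fcst fK //; exact: Rgraph_shift_cst.
have F'K : cancel (fun a : loops H => g (cst a) 0%R)
                  (fun a : loops G => f (cst a) 0%R).
  by move=> a; rewrite -gcst gK //; exact: Rgraph_shift_cst.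
exists (fun a => f (cst a) 0%R), (fun a => g (cst a) 0%R); split=> // a b.
rewrite -!heteroclinicP; split=> ab.
  apply: (conj_heteroclinic Rgraph_shift_shiftz fGH fct f_shift) ab;
    exact: Rgraph_shift_cst.
rewrite -(FK a) -(FK b).
by apply: (conj_heteroclinic Rgraph_shift_shiftz gHG gct g_shift) ab;
  exact: Rgraph_shift_cst.
Qed.

Theorem theorem4p1 (G H : Rgraph1)
  (* p is not in P^(1) *)
  (hG : Rrel G <> [set: Eminus G * Eplus G])
  (hGm : [set em : Eminus G | [set em] `*` [set: Eplus G] `<=` Rrel G] = set0)
  (hGp : [set ep : Eplus G | [set: Eminus G] `*` [set ep] `<=` Rrel G] = set0)
  (hH : Rrel H <> [set: Eminus H * Eplus H])
  (hHm : [set em : Eminus H | [set em] `*` [set: Eplus H] `<=` Rrel H] = set0)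
  (hHp : [set ep : Eplus H | [set: Eminus H] `*` [set ep] `<=` Rrel H] = set0)
  (hconj : topologically_conjugate (Rgraph_shift G) (Rgraph_shift H)) :
  Rgraph1_iso G H.
Proof.
have [F [F' [FK F'K FJ]]] := conj_joined hconj.
have unjoined e g : ~ Rrel G (e, g) -> ~ joined (F (inl e)) (F (inr g)).
  by move=> neg /FJ /(_ e g erefl erefl).
(* By [hGm], [e] has some [g] with (e, g) outside R; the image pair is not joined, which forces its
   left member into E^-. *)
have [phi Fphi] : {phi & forall e, F (inl e) = inl (phi e)}.
  apply: (@choice _ _ (fun x y => F (inl x) = inl y)) => e.
  have [g /unjoined neg] : exists g, ~ Rrel G (e, g).
    apply: contrapT => /forallNP eg; suff : set0 e by [].
    by rewrite -hGm => -[_ g] /= [-> _]; apply: contrapT; exact: eg.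
  case: (F (inl e)) neg => [e' _|g' neg]; first by exists e'.
  by case: neg => ? ?.
have [psi Fpsi] : {psi & forall g, F (inr g) = inr (psi g)}.
  apply: (@choice _ _ (fun x y => F (inr x) = inr y)) => g.
  have [e /unjoined neg] : exists e, ~ Rrel G (e, g).
    apply: contrapT => /forallNP eg; suff : set0 g by [].
    by rewrite -hGp => -[e _] /= [_ ->]; apply: contrapT; exact: eg.
  case: (F (inr g)) neg => [e' neg|g' _]; last by exists g'.
  by case: neg => ? ?.
(* If [F'] sent [inl e] to some [inr g], then applying [F] would give [inr (psi g) = inl e]. *)
have [phi' Fphi'] : {phi' & forall e, F' (inl e) = inl (phi' e)}.
  apply: (@choice _ _ (fun x y => F' (inl x) = inl y)) => e.
  case E: (F' (inl e)) => [e'|g]; first by exists e'.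
  by have := F'K (inl e); rewrite E Fpsi.
have [psi' Fpsi'] : {psi' & forall g, F' (inr g) = inr (psi' g)}.
  apply: (@choice _ _ (fun x y => F' (inr x) = inr y)) => g.
  case E: (F' (inr g)) => [e|g']; last by exists g'.
  by have := F'K (inr g); rewrite E Fphi.
exists phi, psi; split.
- exists phi' => e.
    by apply: (@inl_inj _ (Eplus G)); rewrite -Fphi' -Fphi FK.
  by apply: (@inl_inj _ (Eplus H)); rewrite -Fphi -Fphi' F'K.
- exists psi' => g.
    by apply: (@inr_inj (Eminus G)); rewrite -Fpsi' -Fpsi FK.
  by apply: (@inr_inj (Eminus H)); rewrite -Fpsi -Fpsi' F'K.
- move=> e g; have := FJ (inl e) (inr g); rewrite Fphi Fpsi => eg.
  split=> [Reg|Reg].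
    by apply: (eg.1 _ (phi e) (psi g)) => // _ _ [<-] [<-].
  by apply: (eg.2 _ e g) => // _ _ [<-] [<-].
Qed.
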